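(* Let $L\ge1$ and let $c_1,\dots,c_L$ be integers with every $c_i\ge1$, and let $\{G_n\}$ be defined by $G_1=1$, $G_{n+1}=c_1G_n+\cdots+c_nG_1+1$ for $1\le n<L$, and $G_{n+1}=c_1G_n+\cdots+c_LG_{n+1-L}$ for $n\ge L$. For $m$ chosen uniformly at random from $[G_n,G_{n+1})$, the individual gap measures $\nu_{m;n}$ converge almost surely in distribution, as $n\to\infty$, to the limiting average gap measure $\nu(x)=\sum_{k\ge0}P(k)\,\delta(x-k)$, where $P(k)=\lim_{n\to\infty}P_n(k)$.
   Context: Legal decompositions: a sum $\sum_{i=1}^{M}a_iG_{M+1-i}$ with $a_1>0$ and all $a_i\ge0$ integers is legal if either (i) $M<L$ and $a_i=c_i$ for $1\le i\le M$, or (ii) there is $s\in\{1,\dots,L\}$ with $a_1=c_1,\dots,a_{s-1}=c_{s-1}$, $a_s<c_s$, $a_{s+1}=\cdots=a_{s+\ell}=0$ for some $\ell\ge0$, and $(a_{s+\ell+i})_{i=1}^{M-s-\ell}$ is legal or empty. Every positive integer has a unique legal decomposition. For $m\in[G_n,G_{n+1})$ write $m=\sum_{j=1}^{k(m)}G_{r_j}$ with $r_1\le\cdots\le r_{k(m)}=n$, listing summands with multiplicity. The individual gap measure is $\nu_{m;n}(x)=\frac{1}{k(m)-1}\sum_{j=2}^{k(m)}\delta(x-(r_j-r_{j-1}))$ (for the single integer $m=G_n$ with $k(m)=1$ it is taken to be the zero measure). $P_n(k)$ is the number of pairs $(m,j)$ with $m\in[G_n,G_{n+1})$, $2\le j\le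 k(m)$, $r_j-r_{j-1}=k$, divided by $\sum_{m=G_n}^{G_{n+1}-1}(k(m)-1)$; the limits $P(k)$ exist. *)

(* Defs.v *)
From HB Require Import structures.
From mathcomp Require Import all_boot all_order all_algebra.
From mathcomp Require Import all_classical all_reals all_analysis.
Import Order.TTheory GRing.Theory Num.Theory.
Import numFieldNormedType.Exports.

Set Implicit Arguments.
Unset Strict Implicit.
Unset Printing Implicit Defensive.

Local Open Scope classical_set_scope.

(* The coefficients c_1, ..., c_L are stored as [:: c_1; ...; c_L], so that
   c_(i+1) = nth 0 c i.  Sequences G are indexed from 1; G 0 is unconstrained
   and never used. *)

Definition recurrence_seq (c : seq nat) (G : nat -> nat) : Prop :=
  [/\ G 1 = 1,
      forall n, 1 <= n < size c ->
        G n.+1 = (\sum_(1 <= i < n.+1) nth 0 c i.-1 * G (n.+1 - i)).+1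
    & forall n, size c <= n ->
        G n.+1 = \sum_(1 <= i < (size c).+1) nth 0 c i.-1 * G (n.+1 - i)].

(* Coefficient lists [:: a_1; ...; a_M].  In legal_block the number called s in
   the usual formulation is p.+1, and b is the tail (a_(s+l+i))_i. *)
Inductive legal (c : seq nat) : seq nat -> Prop :=
| legal_prefix a :
    0 < head 0 a -> size a < size c -> a = take (size a) c -> legal c a
| legal_block p x l b :
    p < size c -> x < nth 0 c p ->
    0 < head 0 (take p c ++ x :: nseq l 0 ++ b) ->
    (b <> [::] -> legal c b) ->
    legal c (take p c ++ x :: nseq l 0 ++ b).

Definition coef_value (G : nat -> nat) (a : seq nat) : nat :=
  \sum_(1 <= i < (size a).+1) nth 0 a i.-1 * G ((size a).+1 - i).

(* Junk value [::] when m has no legal decomposition. *)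
Definition legal_decomposition (c : seq nat) (G : nat -> nat) (m : nat) :
    seq nat :=
  xget [::] [set a | legal c a /\ coef_value G a = m].

(* The indices r_1 <= ... <= r_(k(m)), with multiplicity. *)
Definition summand_indices (c : seq nat) (G : nat -> nat) (m : nat) : seq nat :=
  let a := legal_decomposition c G m in
  flatten [seq nseq (nth 0 a (size a - r)) r | r <- iota 1 (size a)].

Definition num_summands (c : seq nat) (G : nat -> nat) (m : nat) : nat :=
  size (summand_indices c G m).

(* gap c G m j = r_(j+2) - r_(j+1), for j < k(m) - 1. *)
Definition gap (c : seq nat) (G : nat -> nat) (m j : nat) : nat :=
  nth 0 (summand_indices c G m) j.+1 - nth 0 (summand_indices c G m) j.

Local Open Scope ring_scope.

Section measures.
Variable R : realType.
Implicit Types (c : seq nat) (G : nat -> nat).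

(* P_n(k) *)
Definition gap_proportion c G (n k : nat) : R :=
  (\sum_(G n <= m < G n.+1)
     \sum_(j < (num_summands c G m).-1) (gap c G m j == k))%N%:R /
  (\sum_(G n <= m < G n.+1) (num_summands c G m).-1)%N%:R.

(* When k(m) = 1 the sum is empty and this is the zero measure. *)
Definition gap_measure c G (m : nat) :
    {measure set (measurableTypeR R) -> \bar R} :=
  mscale ((num_summands c G m).-1%:R^-1)%:nng
    (msum (fun j => \d_((gap c G m j)%:R : measurableTypeR R))
       (num_summands c G m).-1).

Definition atomic_measure (p : nat -> {nonneg R}) :
    {measure set (measurableTypeR R) -> \bar R} :=
  mseries (fun k => mscale (p k) \d_(k%:R : measurableTypeR R)) 0.

Definition cvg_in_distribution
    (mu_ : nat -> {measure set (measurableTypeR R) -> \bar R})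
    (mu : {measure set (measurableTypeR R) -> \bar R}) : Prop :=
  forall f : R -> R, continuous f -> (exists M : R, forall x, `|f x| <= M) ->
    (\int[mu_ n]_x (f x)%:E)%E @[n --> \oo] --> (\int[mu]_x (f x)%:E)%E.

Definition uniform_on (d : measure_display) (Omega : measurableType d)
    (Pr : probability Omega R) (X : {RV Pr >-> nat}) (a b : nat) : Prop :=
  forall m : nat, distribution Pr X [set m] =
    (if (a <= m < b)%N then ((b - a)%N%:R^-1)%:E else 0%E).

End measures.

(* Main.v *)
Require Import Defs.
From mathcomp Require Import all_boot all_order all_algebra.
From mathcomp Require Import all_classical all_reals all_analysis.
From mathcomp Require Import measurable_realfun.
From mathcomp Require Import ring lra zify.
Import Order.TTheory GRing.Theory Num.Theory.
Import numFieldNormedType.Exports.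

(* Cut a legal decomposition into blocks (c_1, ..., c_p, x) with x < c_(p+1),
   followed by a proper prefix of c.  If q is the positive root of
   c_1 q + ... + c_L q^L = 1, the weights q^(length) make the blocks a
   probability space, and since G_(n+1) - G_n is at least a constant times
   q^(-n), an event of small weight among the strings of length n is also
   unlikely for m uniform in [G_n, G_(n+1)).

   Generate a string from its least significant end by prepending independent
   random blocks.  The number of new gaps of length k depends on the block and on
   the number of leading zeros only; after adding a bounded function of that
   number, the count of gaps equal to k has constant drift.  A Chernoff bound for
   the resulting supermartingale shows that this count is alpha_k n + o(n), and
   likewise the number of summands is kappa n + o(n), outside of events of
   exponentially small probability.  Averaging gives P(k) = alpha_k / kappa, and
   Borel-Cantelli gives almost sure convergence of the masses at every k,
   whatever the joint law of the m_n.  The gaps of m add up to at most n, so the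
   measures are tight and the convergence holds in distribution. *)

Set Implicit Arguments.
Unset Strict Implicit.
Unset Printing Implicit Defensive.
Local Open Scope classical_set_scope.

(** * Legal decompositions as strings of blocks *)

Definition blocks (c : seq nat) : seq (seq nat) :=
  [seq rcons (take p c) x | p <- iota 0 (size c), x <- iota 0 (nth 0 c p)].

(* A legal string padded with any number of leading zeros, or a string of
   zeros. *)
Inductive word (c : seq nat) : seq nat -> Prop :=
| word_prefix t : t < size c -> word c (take t c)
| word_block b w : b \in blocks c -> word c w -> word c (b ++ w).

(* All the digit strings obtained by prepending to [w] blocks of total length
   [m]; [fuel >= m] suffices. *)
Fixpoint extensions (c : seq nat) (fuel m : nat) (w : seq nat) :
    seq (seq nat) :=
  if m == 0 then [:: w] else
  if fuel is f.+1 then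
    flatten [seq extensions c f (m - size b) (b ++ w)
            | b <- [seq b <- blocks c | size b <= m]]
  else [::].

(** This list serves for upper bounds on counts, so repetitions are harmless as long as every word
    of length [n] occurs. *)
Definition words (c : seq nat) (n : nat) : seq (seq nat) :=
  flatten [seq extensions c n (n - t) (take t c) | t <- iota 0 (size c) & t <= n].

Section Blocks.
Variable c : seq nat.

Lemma blocksP b : reflect
  (exists p x, [/\ p < size c, x < nth 0 c p & b = rcons (take p c) x])
  (b \in blocks c).
Proof.
apply: (iffP allpairsPdep) => [[p [x [hp hx ->]]]|[p [x [hp hx ->]]]].
  by exists p, x; move: hp hx; rewrite !mem_iota.
by exists p, x; rewrite !mem_iota.
Qed.

Lemma size_block p (x : nat) : p < size c -> size (rcons (take p c) x) = p.+1.
Proof. by move=> hp; rewrite size_rcons size_takel// ltnW. Qed.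

Lemma size_blocks b : b \in blocks c -> 0 < size b <= size c.
Proof. by move=> /blocksP[p [x [hp _ ->]]]; rewrite size_block. Qed.

(** [word_block] adds the outermost block, whereas [extensions] recurses from the innermost one;
    induction on the fuel passes from one order to the other. *)
Lemma extensions_cat f m w b a : b \in blocks c ->
  a \in extensions c f m w ->
  b ++ a \in extensions c (f + size b) (m + size b) w.
Proof.
move=> hb; have /andP[b0 _] := size_blocks hb.
have step g k v : k != 0 -> extensions c g.+1 k v =
    flatten [seq extensions c g (k - size b) (b ++ v)
            | b <- [seq b <- blocks c | size b <= k]].
  by move=> /negPf /= ->.
have base g v : b ++ v \in extensions c (g + size b) (size b) v.
  rewrite -(prednK b0) addnS step // prednK//.
  apply/flatten_mapP; exists b; first by rewrite mem_filter leqnn.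
  by rewrite subnn; case: (_ + _) => [|k] /=; rewrite mem_head.
elim: f m w => [|f IH] m w.
  by rewrite /=; case: eqP => // -> /[!inE] /eqP ->; exact: (base 0).
have [->|m0] := eqVneq m 0.
  by rewrite /= inE => /eqP ->; exact: (base f.+1).
rewrite step// => /flatten_mapP[b']; rewrite mem_filter => /andP[b'm hb'] ha.
rewrite addSn step; last by rewrite addn_eq0 (negPf m0).
apply/flatten_mapP; exists b'.
  by rewrite mem_filter hb' andbT (leq_trans b'm) // leq_addr.
by rewrite -addnBAC//; apply: IH.
Qed.

Lemma mem_words a : word c a -> a \in words c (size a).
Proof.
elim=> [t ht|b w hb hw /flatten_mapP[t]].
  have ts : size (take t c) = t by rewrite size_takel// ltnW.
  apply/flatten_mapP; exists t; first by rewrite mem_filter mem_iota ts leqnn.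
  by rewrite ts subnn; case: (t) => [|k] /=; rewrite mem_head.
rewrite mem_filter => /andP[tw ht] /(extensions_cat hb).
rewrite addnBAC// -[size w + _]addnC -size_cat => hw'.
apply/flatten_mapP; exists t => //.
by rewrite mem_filter ht andbT size_cat (leq_trans tw)// leq_addl.
Qed.

Lemma size_extensions f m w a :
  a \in extensions c f m w -> size a = m + size w.
Proof.
elim: f m w => [|f IH] m w /=; case: eqP => //.
- by move=> -> /[!inE]/eqP ->.
- by move=> -> /[!inE]/eqP ->.
move=> _ /flatten_mapP[b].
rewrite mem_filter => /andP[bm _] /IH ->.
by rewrite size_cat addnA subnK.
Qed.

Lemma size_words n a : a \in words c n -> size a = n.
Proof.
move=> /flatten_mapP[t]; rewrite mem_filter mem_iota => /andP[tn /= tc].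
by move=> /size_extensions ->; rewrite size_takel ?subnK// ltnW.
Qed.

End Blocks.

(** * Existence and length of legal decompositions *)

Section Decomposition.
Variables (c : seq nat) (G : nat -> nat).
Hypothesis c0 : 0 < size c.
Hypothesis cpos : forall i, i < size c -> 0 < nth 0 c i.
Hypothesis hG : recurrence_seq c G.

(** One formula for the three clauses: for [n = 0] the sum is empty and the boolean supplies
    [G 1 = 1]. *)
Lemma recurrence_seqS n :
  G n.+1 = \sum_(i < minn n (size c)) nth 0 c i * G (n - i) + (n < size c).
Proof.
have reidx k : \sum_(1 <= i < k.+1) nth 0 c i.-1 * G (n.+1 - i) =
    \sum_(i < k) nth 0 c i * G (n - i).
  by rewrite big_add1 /= big_mkord; apply: eq_bigr => i _; rewrite subSS.
case: hG => G1 Glt Gge; case: (ltnP n (size c)) => hn.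
  rewrite addn1; case: n hn reidx => [|n] hn reidx.
    by rewrite big_ord0 G1.
  by rewrite Glt// reidx.
by rewrite Gge// reidx addn0.
Qed.

Lemma coef_valueE a :
  coef_value G a = \sum_(i < size a) nth 0 a i * G (size a - i).
Proof.
rewrite /coef_value big_add1 /= big_mkord.
by apply: eq_bigr => i _; rewrite subSS.
Qed.

Lemma coef_value_cat u w : coef_value G (u ++ w) =
  \sum_(i < size u) nth 0 u i * G (size u + size w - i) + coef_value G w.
Proof.
rewrite !coef_valueE size_cat big_split_ord /=; congr (_ + _).
  by apply: eq_bigr => i _; rewrite nth_cat ltn_ord.
apply: eq_bigr => i _.
by rewrite nth_cat ltnNge leq_addr /= addKn subnDl.
Qed.

Lemma coef_value_cons d w : coef_value G (d :: w) =
  d * G (size w).+1 + coef_value G w.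
Proof. by rewrite -cat1s coef_value_cat big_ord1. Qed.

Lemma coef_value_block p x w : p < size c ->
  coef_value G (rcons (take p c) x ++ w) =
  \sum_(i < p) nth 0 c i * G (p + (size w).+1 - i) + x * G (size w).+1
    + coef_value G w.
Proof.
move=> hp; rewrite cat_rcons coef_value_cat coef_value_cons addnA.
rewrite size_takel ?(ltnW hp)//; congr (_ + _ + _).
by apply: eq_bigr => i _; rewrite nth_take.
Qed.

Lemma recurrence_seq_gt0 n : 0 < G n.+1.
Proof.
elim: n => [|n IH]; first by case: hG => ->.
rewrite recurrence_seqS.
case E: (minn n.+1 (size c)) => [|k]; first by move: E c0; lia.
by rewrite big_ord_recl /= subn0 !addn_gt0 muln_gt0 cpos// IH.
Qed.

Lemma leq_recurrence_seq n p : p <= n -> p <= size c ->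
  \sum_(i < p) nth 0 c i * G (n - i) <= G n.+1.
Proof.
move=> pn pc; rewrite recurrence_seqS.
have pm : p <= minn n (size c) by rewrite leq_min pn.
by rewrite -(subnKC pm) big_split_ord /= -addnA leq_addr.
Qed.

Lemma recurrence_seq_nondecreasing i j : 0 < i <= j -> G i <= G j.
Proof.
move=> /andP[i0 ij]; rewrite -(subnKC ij).
elim: (j - i) => [|k IH]; first by rewrite addn0.
rewrite addnS; apply: leq_trans IH _.
have := @leq_recurrence_seq (i + k) 1 ltac:(lia) c0.
by rewrite big_ord1 subn0; apply: leq_trans; rewrite leq_pmull// cpos.
Qed.

(** A proper prefix of [c] yields the sum in the recurrence short of the extra 1. In a block,
    [x < c_(p+1)] leaves a spare copy of [G (size w).+1], which exceeds the value of [w] by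
    induction. *)
Lemma word_lt a : word c a -> coef_value G a < G (size a).+1.
Proof.
elim=> [t ht|b w /blocksP[p [x [hp hx ->]]] hw IH].
  rewrite -[take t c]cats0 coef_value_cat size_cat size_takel ?(ltnW ht)//=.
  rewrite recurrence_seqS addn0 ht (minn_idPl (ltnW ht)) addn1 ltnS.
  rewrite coef_valueE big_ord0 addn0; apply: leq_sum => i _.
  by rewrite nth_take.
rewrite coef_value_block// size_cat size_block// addSnnS.
have := @leq_recurrence_seq (p + (size w).+1) p.+1 _ hp.
rewrite big_ord_recr /= addKn => /(_ ltac:(lia)); apply: leq_trans.
have : x.+1 * G (size w).+1 <= nth 0 c p * G (size w).+1.
  by rewrite leq_mul2r hx orbT.
rewrite mulSn; move: IH; move: (coef_value _ _) => y; lia.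
Qed.

Lemma word_exists n m : m < G n.+1 ->
  exists a, [/\ word c a, size a = n & coef_value G a = m].
Proof.
elim/ltn_ind: n m => n IH m.
rewrite recurrence_seqS; set S := fun p => \sum_(i < p) nth 0 c i * G (n - i).
move=> hm.
(* In the initial range the value just below [G n.+1] is attained by a proper prefix of [c]. *)
have [/andP[nc /eqP ->]|hnm] := boolP ((n < size c) && (m == S n)).
  exists (take n c); split; first exact: word_prefix.
    by rewrite size_takel// ltnW.
  rewrite coef_valueE size_takel ?(ltnW nc)//.
  by apply: eq_bigr => i _; rewrite nth_take.
have hS : m < S (minn n (size c)).
  move: hm hnm; rewrite -/(S _); case: (ltnP n (size c)) => hn /=.
    by rewrite addn1 ltnS ltn_neqAle => -> ->.
  by rewrite addn0.
have exS : exists p, m < S p by exists (minn n (size c)).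
case: (ex_minnP exS) => -[|p]; first by rewrite /S big_ord0.
move=> hp pmin.
have := pmin _ hS; rewrite leq_min => /andP[pn pc].
have Sp : S p <= m by rewrite leqNgt; apply/negP => /pmin; rewrite ltnn.
have Gp : G (n - p) = G (n - p.+1).+1 by congr G; lia.
have G0 : 0 < G (n - p) by rewrite Gp recurrence_seq_gt0.
(* As [S p <= m < S p.+1], the greedy digits are [c_1, ..., c_p] and then a quotient [x < c_(p+1)];
   the remainder is expanded by induction. *)
set x := (m - S p) %/ G (n - p).
set r := (m - S p) %% G (n - p).
have lt_n : n - p.+1 < n by lia.
have lt_r : r < G (n - p.+1).+1 by rewrite -Gp ltn_pmod.
have [w [hw sw vw]] := IH _ lt_n _ lt_r.
exists (rcons (take p c) x ++ w); split.
- apply: word_block => //; apply/blocksP; exists p, x; split=> //.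
  rewrite ltn_divLR// ltn_subLR//.
  by move: hp; rewrite /S big_ord_recr.
- by rewrite size_cat size_block// sw subnKC.
- rewrite coef_value_block// vw sw -Gp -addnA -divn_eq.
  rewrite -[RHS](subnKC Sp); congr (_ + _).
  by apply: eq_bigr => i _; congr (_ * G _); lia.
Qed.

Lemma word_zeros l w : word c w -> word c (nseq l 0 ++ w).
Proof.
move=> hw; elim: l => //= l IH; rewrite -cat1s; apply: word_block => //.
by apply/blocksP; exists 0, 0; rewrite take0 c0 cpos.
Qed.

Lemma word_nil : word c [::].
Proof. by rewrite -(take0 c); apply: word_prefix. Qed.

Lemma legal_word a : legal c a -> word c a.
Proof.
elim=> [{}a _ sa ->|p x l b hp hx _ hb IH]; first exact: word_prefix.
rewrite -cat_rcons; apply: word_block.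
  by apply/blocksP; exists p, x.
case: b hb IH => [|d b] hb IH; last by apply: word_zeros; apply: IH.
by apply: word_zeros; exact: word_nil.
Qed.

(** Leading blocks [[:: 0]] join the run of zeros; any other block begins with a positive digit,
    every coefficient being positive, and so starts a legal string. *)
Lemma word_legal a : word c a ->
  exists l b, a = nseq l 0 ++ b /\ (b <> [::] -> legal c b).
Proof.
have h0 p : 0 < p <= size c -> 0 < head 0 (take p c).
  case: p => // p /andP[_ pc]; rewrite -nth0 nth_take//; exact: cpos.
elim=> [t ht|b w /blocksP[p [x [hp hx ->]]] hw [l [b' [-> hb']]]].
  exists 0, (take t c); split=> // /eqP; rewrite -size_eq0.
  rewrite size_takel ?(ltnW ht)// -lt0n => t0.
  apply: legal_prefix; rewrite ?size_takel ?(ltnW ht)//.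
  by apply: h0; rewrite t0 ltnW.
have [/andP[/eqP p0 /eqP x0]|px] := boolP ((p == 0) && (x == 0)).
  by exists l.+1, b'; rewrite p0 x0 take0.
exists 0, (rcons (take p c) x ++ nseq l 0 ++ b'); split=> // _.
rewrite cat_rcons; apply: legal_block => //.
case: p hp hx px => [|p] hp hx px; first by rewrite take0 /=; lia.
have := h0 p.+1; rewrite /= (ltnW hp) => /(_ isT).
by case: (take _ c).
Qed.

Lemma legal_decompositionP n m : 0 < n -> G n <= m < G n.+1 ->
  [/\ word c (legal_decomposition c G m), size (legal_decomposition c G m) = n
    & coef_value G (legal_decomposition c G m) = m].
Proof.
case: n => // n _ /andP[mn mn1].
have [a [aw sa va]] := word_exists mn1.
have la : legal c a.
  have [l [b [ab hb]]] := word_legal aw.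
  (* A leading zero would force [m < G n.+1] by [word_lt], against the lower bound on [m]. *)
  have ahd : 0 < head 0 a.
    case: l ab => [|l] ab.
      by have : legal c a; [rewrite ab; apply: hb => b0; rewrite ab b0 in sa|case].
    have wb : word c b.
      by case: (b) hb => [_|d b1 /(_ ltac:(done))/legal_word//]; exact: word_nil.
    have := word_lt (word_zeros l wb).
    move: va sa; rewrite ab /= coef_value_cons mul0n add0n => -> [->]; lia.
  case: l ab => [|l] ab; last by rewrite ab in ahd.
  by rewrite ab; apply: hb => b0; rewrite ab b0 in ahd.
(* Whichever decomposition [xget] picks, its positive first digit and [word_lt] put [m] in
   [[G (size a'), G (size a').+1)]; monotonicity of [G] then forces the length. *)
rewrite /legal_decomposition; case: xgetP => [a' _ [la' va']|/(_ a)]; last first.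
  by case; split.
have wa' := legal_word la'; split=> //.
have a'0 : 0 < head 0 a' by case: la'.
have lo : G (size a') <= m.
  rewrite -va'; case: (a') a'0 => //= d w d0.
  rewrite coef_value_cons; nia.
have hi := word_lt wa'; rewrite va' in hi.
have sa'0 : 0 < size a' by case: (a') a'0.
apply/eqP; rewrite eqn_leq; apply/andP; split; rewrite leqNgt; apply/negP => h.
  have := @recurrence_seq_nondecreasing n.+2 (size a') h; lia.
have := @recurrence_seq_nondecreasing (size a').+1 n.+1 h.
by move=> /(leq_trans hi)/leq_trans/(_ mn); rewrite ltnn.
Qed.

End Decomposition.

(** * Gaps *)

(* [z] is the number of zeros at the head of the digits that follow [u]. *)
Fixpoint leading_zeros (z : nat) (u : seq nat) : nat :=
  if u is d :: u' then if d == 0 then (leading_zeros z u').+1 else 0 else z.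

(* The gaps r_1 - 0, r_2 - r_1, ... : with the artificial index r_0 = 0, the
   gaps created by prepending digits to w depend only on [leading_zeros 0 w].
   The genuine gaps are the [behead] of this list. *)
Fixpoint gaps (z : nat) (u : seq nat) : seq nat :=
  if u is d :: u' then
    gaps z u' ++
    (if d is d'.+1 then (leading_zeros z u').+1 :: nseq d' 0 else [::])
  else [::].

Lemma leading_zeros_cat z u w :
  leading_zeros z (u ++ w) = leading_zeros (leading_zeros z w) u.
Proof. by elim: u => //= d u ->. Qed.

Lemma gaps_cat z u w :
  gaps z (u ++ w) = gaps z w ++ gaps (leading_zeros z w) u.
Proof.
elim: u => [|d u IH] /=; first by rewrite cats0.
by rewrite IH leading_zeros_cat catA.
Qed.

Lemma size_gaps z u : size (gaps z u) = sumn u.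
Proof.
elim: u => //= d u IH; rewrite size_cat IH addnC.
by case: d => //= d; rewrite size_nseq.
Qed.

Lemma leading_zeros_le u : leading_zeros 0 u <= size u.
Proof. by elim: u => //= d u IH; case: eqP. Qed.

(** The gaps telescope to the largest index. This later bounds the total gap length by [n]. *)
Lemma sumn_gaps u : sumn (gaps 0 u) + leading_zeros 0 u = size u.
Proof.
elim: u => //= d u IH; rewrite sumn_cat.
case: d => [|d] /=; first by rewrite addn0 addnS IH.
by rewrite sumn_nseq mul0n !addn0 addnS IH.
Qed.

(** A run of at least [k] zeros can only close with a gap larger than [k], so its exact length does
    not affect the count. *)
Lemma count_gaps_stable k z z' u : k <= z -> k <= z' ->
  count_mem k (gaps z u) = count_mem k (gaps z' u).
Proof.
move=> kz kz'.
(* The induction must also carry that the two runs agree or both still have length at least [k]. *)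
suff : count_mem k (gaps z u) = count_mem k (gaps z' u) /\
  (leading_zeros z u = leading_zeros z' u \/
   k <= leading_zeros z u /\ k <= leading_zeros z' u) by case.
elim: u => [|d u [IH1 IH2]] /=; first by split=> //; right.
rewrite !count_cat IH1; split.
  congr (_ + _); case: d => //= d; congr (_ + _).
  case: IH2 => [->//|[h1 h2]].
  by rewrite !gtn_eqF.
by case: eqP => _; [case: IH2 => [->|[h1 h2]]; [left|right; lia]|left].
Qed.

(** A block with [p > 0] begins with [c_1 > 0], so only [[:: 0]] lengthens a run of zeros and every
    other block resets it. *)
Lemma leading_zeros_block c z b : (forall i, i < size c -> 0 < nth 0 c i) ->
  b \in blocks c ->
  leading_zeros z b = if b == [:: 0] then z.+1 else 0.
Proof.
move=> cpos /blocksP[[|p] [x [hp hx ->]]].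
  by rewrite take0 /= eqseq_cons andbT.
have := cpos 0 (leq_ltn_trans (leq0n _) hp).
by case: c cpos hp {hx} => //= d c _ _; case: d.
Qed.

(** [summand_indices] for an arbitrary digit string, which allows induction on the digits. *)
Definition digit_indices (a : seq nat) : seq nat :=
  flatten [seq nseq (nth 0 a (size a - r)) r | r <- iota 1 (size a)].

Lemma digit_indices_cons d w :
  digit_indices (d :: w) = digit_indices w ++ nseq d (size w).+1.
Proof.
rewrite /digit_indices [size _]/= -addn1 iotaD map_cat flatten_cat; congr (_ ++ _).
  congr flatten; apply/eq_in_map => r; rewrite mem_iota => /andP[r1 r2].
  by rewrite addn1 subSn//.
by rewrite /= add1n addn1 subnn cats0.
Qed.

Lemma last_digit_indices a :
  last 0 (digit_indices a) = size a - leading_zeros 0 a.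
Proof.
elim: a => // d w IH; rewrite digit_indices_cons last_cat IH.
case: d => [|d] /=; first by rewrite subSS.
by elim: d.
Qed.

Lemma pairmap_digit_indices a :
  pairmap (fun x y => y - x) 0 (digit_indices a) = gaps 0 a.
Proof.
elim: a => // d w IH.
rewrite digit_indices_cons pairmap_cat IH last_digit_indices /=; congr (_ ++ _).
case: d => //= d; congr cons.
  by have := leading_zeros_le w; lia.
by elim: d => //= d ->; rewrite subnn.
Qed.

(** The operation is arbitrary in order to cover both the counts in [nat] and the integrals in
    [R]. *)
Lemma big_gap (T : Type) (idx : T) (op : T -> T -> T) c G m F :
  \big[op/idx]_(j < (num_summands c G m).-1) F (gap c G m j) =
  \big[op/idx]_(g <- behead (gaps 0 (legal_decomposition c G m))) F g.
Proof.
rewrite -pairmap_digit_indices /num_summands /gap.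
change (summand_indices c G m) with
  (digit_indices (legal_decomposition c G m)).
case: (digit_indices _) => [|x s] /=; first by rewrite big_ord0 big_nil.
rewrite (big_nth 0) size_pairmap big_mkord; apply: eq_bigr => j _.
by rewrite (nth_pairmap 0).
Qed.

Lemma num_summandsE c G m :
  num_summands c G m = sumn (legal_decomposition c G m).
Proof.
rewrite -(size_gaps 0) -pairmap_digit_indices size_pairmap.
by [].
Qed.

Lemma sum_gap_eq c G m k :
  \sum_(j < (num_summands c G m).-1) (gap c G m j == k) =
  count_mem k (behead (gaps 0 (legal_decomposition c G m))).
Proof.
rewrite (big_gap 0 addn c G m (fun g => nat_of_bool (g == k))).
by elim: (behead _) => [|g s IH]; rewrite ?big_nil ?big_cons //= IH.
Qed.

(** * Concentration *)

Local Open Scope ring_scope.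

Section Concentration.
Variables (R : realType) (c : seq nat) (q : R).
Hypothesis q0 : 0 < q.
Hypothesis sum_q : \sum_(b <- blocks c) q ^+ size b = 1.

(* Optional stopping: prepending random blocks until the total length is [m]
   cannot increase the mean of a nonnegative supermartingale. *)
Lemma sum_extensions_le (M : seq nat -> R) f m w :
  (forall u, 0 <= M u) ->
  (forall u, \sum_(b <- blocks c) M (b ++ u) <= M u) ->
  \sum_(a <- extensions c f m w) M a <= M w.
Proof.
move=> M0 Mle; elim: f m w => [|f IH] m w /=; case: eqP => _;
  rewrite ?big_seq1 ?big_nil//.
rewrite big_flatten big_map big_filter; apply: le_trans (Mle w).
rewrite [leRHS](bigID (fun b : seq nat => (size b <= m)%N)) /= -[leLHS]addr0.
apply: lerD; first by apply: ler_sum => b _; exact: IH.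
by apply: sumr_ge0.
Qed.

Lemma sum_words_le (M : seq nat -> R) n :
  (forall u, 0 <= M u) ->
  (forall u, \sum_(b <- blocks c) M (b ++ u) <= M u) ->
  \sum_(a <- words c n) M a <= \sum_(t < size c) M (take t c).
Proof.
move=> M0 Mle; rewrite /words big_flatten big_map big_filter.
rewrite -[leRHS](big_mkord xpredT (fun t => M (take t c))) /index_iota subn0.
rewrite [leRHS](bigID (fun t : nat => (t <= n)%N)) /= -[leLHS]addr0.
apply: lerD; first by apply: ler_sum => b _; exact: sum_extensions_le.
by apply: sumr_ge0.
Qed.

(** From [expR (- y) >= 1 - y], since [(1 + y + 2 * y ^+ 2) * (1 - y) = 1 + y ^+ 2 * (1 - 2 *
    y)]. *)
Lemma expR_le_quadratic (y : R) : y <= 2^-1 -> expR y <= 1 + y + 2 * y ^+ 2.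
Proof.
move=> y2.
have e1 := expR_ge1Dx (- y); rewrite expRN in e1.
have y1 : 0 < 1 - y by lra.
have e0 := expR_gt0 y.
have h : expR y * (1 - y) <= 1.
  by rewrite -ler_pdivlMl// mulr1.
have : 1 <= (1 + y + 2 * y ^+ 2) * (1 - y) by nra.
move=> h2; rewrite -(ler_pM2r y1); exact: le_trans h h2.
Qed.

Definition mean (F : seq nat -> R) : R :=
  \sum_(b <- blocks c) q ^+ size b * F b.

(** A large deviation bound, each string of length [n] having weight [q ^+ n]. The threshold [N]
    makes it stable under bounded perturbations of [X]. *)
Definition concentrated (X : seq nat -> R) (al : R) : Prop :=
  forall e : R, 0 < e -> exists (C r : R) (N : nat),
    [/\ 0 <= C, 0 <= r, r < 1 & forall n, (N <= n)%N ->
    (count (fun a => e * n%:R < `|X a - al * n%:R|) (words c n))%:R * q ^+ n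
      <= C * r ^+ n].

(* Chernoff bound: for small [t], the function
   [q ^+ size u * expR (t * (X u - (al + e / 2) * size u))] is a
   supermartingale, because its increments have negative drift. *)
Lemma upper_tail (X : seq nat -> R) (al M : R) :
  (forall b w, b \in blocks c -> `|X (b ++ w) - X w| <= M) ->
  (forall w, mean (fun b => X (b ++ w) - X w) =
             al * mean (fun b => (size b)%:R)) ->
  forall e : R, 0 < e -> exists C r : R,
    [/\ 0 <= C, 0 <= r, r < 1 & forall n,
    (count (fun a => e * n%:R < X a - al * n%:R) (words c n))%:R * q ^+ n
      <= C * r ^+ n].
Proof.
move=> XM Xal e e0.
have e2 : 0 < e / 2 by lra.
pose L : R := (size c)%:R.
have L0 : 0 <= L by rewrite ler0n.
have M0 : blocks c != [::] -> 0 <= M.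
  case E: (blocks c) => [//|b s] _.
  have := XM b [::]; rewrite E mem_head => /(_ isT); exact: le_trans.
have M0' : 0 <= M.
  apply: M0; apply/eqP => E; have := sum_q; rewrite E big_nil => /eqP.
  by rewrite eq_sym oner_eq0.
pose M1 : R := M + `|al| * L + (e / 2) * L + 1 + e.
have alL : 0 <= `|al| * L by rewrite mulr_ge0.
have eL : 0 <= (e / 2) * L by rewrite mulr_ge0// ltW.
have M1e : e <= M1 by rewrite /M1; lra.
have M1pos : 0 < M1 by lra.
(* This [t] makes the second-order error [2 * (t * M1) ^+ 2] equal to [t * (e / 2)], which the drift
   [- t * (e / 2) * mu] absorbs because the mean block length [mu] is at least 1. [M1 >= e] ensures
   [t * M1 <= 2^-1]. *)
pose t : R := (e / 2) / (2 * M1 ^+ 2).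
have t0 : 0 < t by rewrite divr_gt0// mulr_gt0// exprn_gt0.
have tM : 2 * t * M1 ^+ 2 = e / 2.
  rewrite /t; field; lra.
have tM1 : t * M1 <= 2^-1.
  have : t * M1 * (4 * M1) = e by move: tM; rewrite expr2; lra.
  by nra.
pose W u : R := q ^+ size u * expR (t * (X u - (al + e / 2) * (size u)%:R)).
have W0 u : 0 <= W u by rewrite mulr_ge0 ?expR_ge0// exprn_ge0// ltW.
have Wle u : \sum_(b <- blocks c) W (b ++ u) <= W u.
  pose y b : R := t * (X (b ++ u) - X u - (al + e / 2) * (size b)%:R).
  have -> : \sum_(b <- blocks c) W (b ++ u) =
      W u * \sum_(b <- blocks c) q ^+ size b * expR (y b).
    rewrite big_distrr /=; apply: eq_bigr => b _.
    rewrite /W size_cat exprD natrD /y.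
    have -> : t * (X (b ++ u) - (al + e / 2) * ((size b)%:R + (size u)%:R)) =
      t * (X u - (al + e / 2) * (size u)%:R) +
      t * (X (b ++ u) - X u - (al + e / 2) * (size b)%:R) by lra.
    rewrite expRD; set E1 := expR _; set E2 := expR _; lra.
  rewrite -[leRHS]mulr1 ler_wpM2l//.
  have yb b : b \in blocks c -> `|y b| <= t * M1.
    move=> hb; rewrite /y normrM gtr0_norm// ler_pM2l//.
    have hs : (size b)%:R <= L by rewrite ler_nat; case/andP: (size_blocks hb).
    have s0 : 0 <= (size b)%:R :> R by [].
    apply: le_trans (ler_normB _ _) _.
    have h1 := XM _ u hb.
    have h2 : `|(al + e / 2) * (size b)%:R| <= (`|al| + e / 2) * L.
      rewrite normrM (ger0_norm s0); apply: ler_pM => //.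
      by apply: le_trans (ler_normD _ _) _; rewrite (gtr0_norm e2).
    by rewrite /M1; lra.
  apply: (@le_trans _ _ (\sum_(b <- blocks c)
     q ^+ size b * (1 + y b + 2 * (t * M1) ^+ 2))).
    rewrite big_seq [leRHS]big_seq; apply: ler_sum => b hb.
    rewrite ler_wpM2l//; first by rewrite exprn_ge0// ltW.
    have h := yb b hb.
    apply: le_trans (expR_le_quadratic _) _.
      by apply: le_trans (ler_norm _) _; exact: le_trans h tM1.
    rewrite lerD2l ler_pM2l// -real_normK ?num_real//.
    by rewrite ler_sqr ?nnegrE// mulr_ge0// ltW.
  have -> : \sum_(b <- blocks c) q ^+ size b * (1 + y b + 2 * (t * M1) ^+ 2) =
     (1 + 2 * (t * M1) ^+ 2) * \sum_(b <- blocks c) q ^+ size b +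
     t * (mean (fun b => X (b ++ u) - X u) -
          (al + e / 2) * mean (fun b => (size b)%:R)).
    rewrite /mean !big_distrr -sumrN -!big_split big_distrr -big_split /=.
    apply: eq_bigr => b _; rewrite /y; lra.
  rewrite sum_q mulr1 Xal.
  have mu1 : 1 <= mean (fun b => (size b)%:R).
    rewrite -[leLHS]sum_q /mean big_seq [leRHS]big_seq; apply: ler_sum => b hb.
    apply: ler_peMr; first by rewrite exprn_ge0// ltW.
    by rewrite ler1n; case/andP: (size_blocks hb).
  set mu := mean _ in mu1 *.
  have -> : 2 * (t * M1) ^+ 2 = t * (e / 2) by rewrite -tM exprMn; lra.
  have te : 0 < t * (e / 2) by rewrite mulr_gt0.
  nra.
exists (\sum_(i < size c) W (take i c)), (expR (- (t * (e / 2)))); split.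
- by apply: sumr_ge0.
- exact: expR_ge0.
- by rewrite expR_lt1 oppr_lt0 mulr_gt0.
move=> n; rewrite -sum1_count natr_sum big_distrl /= -expRM_natl.
(* Markov's inequality: a counted string satisfies [q ^+ n <= W a * expR (n%:R * - (t * (e /
   2)))]. *)
apply: le_trans
  (_ : \sum_(a <- words c n) W a * expR (n%:R * - (t * (e / 2))) <= _); last first.
  by rewrite -big_distrl /= ler_wpM2r ?expR_ge0// sum_words_le.
rewrite big_mkcond big_seq [leRHS]big_seq; apply: ler_sum => a /size_words sa.
case: ifPn => [ha|_]; last by rewrite mulr_ge0// expR_ge0.
rewrite mul1r /W sa -mulrA -expRD.
apply: ler_peMr; first by rewrite exprn_ge0// ltW.
rewrite -[leLHS]expR0 ler_expR.
have -> : t * (X a - (al + e / 2) * n%:R) + n%:R * - (t * (e / 2)) =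
  t * (X a - al * n%:R - e * n%:R) by lra.
rewrite mulr_ge0 ?(ltW t0)// subr_ge0; exact: ltW.
Qed.

Lemma concentrated_drift (X : seq nat -> R) (al M : R) :
  (forall b w, b \in blocks c -> `|X (b ++ w) - X w| <= M) ->
  (forall w, mean (fun b => X (b ++ w) - X w) =
             al * mean (fun b => (size b)%:R)) ->
  concentrated X al.
Proof.
move=> XM Xal e e0.
have [C1 [r1 [C10 r10 r11 h1]]] := upper_tail XM Xal e0.
have XM' b w : b \in blocks c -> `|- X (b ++ w) - - X w| <= M.
  by move=> hb; rewrite -opprB normrN opprK addrC XM.
have Xal' w : mean (fun b => - X (b ++ w) - - X w) =
             - al * mean (fun b => (size b)%:R).
  rewrite mulNr -(Xal w) /mean -sumrN; apply: eq_bigr => b _; lra.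
have [C2 [r2 [C20 r20 r21 h2]]] := upper_tail XM' Xal' e0.
exists (C1 + C2), (Num.max r1 r2), 0%N; split.
- exact: addr_ge0.
- by rewrite le_max r10.
- by rewrite gt_max r11.
move=> n _; rewrite mulrDl.
apply: le_trans (lerD (le_trans (h1 n) _) (le_trans (h2 n) _)).
- rewrite -mulrDl ler_wpM2r ?exprn_ge0 ?(ltW q0)// -natrD ler_nat.
  rewrite -count_predUI; apply: leq_trans (leq_addr _ _).
  apply: sub_count => a /=; rewrite ltr_normr => /orP[->//|h].
  by apply/orP; right; move: h; lra.
- apply: ler_wpM2l => //; apply: lerXn2r; rewrite ?nnegrE ?le_max ?r10//.
  by rewrite lexx.
- apply: ler_wpM2l => //; apply: lerXn2r; rewrite ?nnegrE ?le_max ?r10//.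
  by rewrite lexx orbT.
Qed.

(** From [N1] on, the bounded error is at most half of the allowed deviation [e * n]. *)
Lemma concentrated_bounded_diff (X Y : seq nat -> R) (al A : R) :
  (forall a, `|Y a - X a| <= A) -> concentrated X al -> concentrated Y al.
Proof.
move=> XY hX e e0; have e2 : 0 < e / 2 by lra.
have [C [r [N [C0 r0 r1 h]]]] := hX _ e2.
pose N1 := (Num.truncn (A / (e / 2))).+1.
exists C, r, (maxn N N1); split=> // n; rewrite geq_max => /andP[nN nN1].
apply: le_trans (h n nN); rewrite ler_wpM2r ?exprn_ge0 ?(ltW q0)// ler_nat.
apply: sub_count => a /= ha.
have : A <= (e / 2) * n%:R.
  rewrite mulrC -ler_pdivrMr//; apply: ltW.
  apply: lt_le_trans (truncnS_gt _) _.
  by rewrite ler_nat.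
have := XY a; have : `|Y a - al * n%:R| <= `|Y a - X a| + `|X a - al * n%:R|.
  by apply: le_trans (ler_normD _ _); rewrite subrKA.
lra.
Qed.

End Concentration.

(** * Drift of the gap counts *)

Section Drift.
Variables (R : realType) (c : seq nat) (q : R).
Hypothesis q0 : 0 < q.
Hypothesis sum_q : \sum_(b <- blocks c) q ^+ size b = 1.
Hypothesis cpos : forall i, (i < size c)%N -> (0 < nth 0%N c i)%N.

Local Notation mean := (mean c q).

Lemma mean_ge0 F : (forall b, b \in blocks c -> 0 <= F b) -> 0 <= mean F.
Proof.
move=> F0; rewrite /mean big_seq; apply: sumr_ge0 => b hb.
by rewrite mulr_ge0 ?F0// exprn_ge0// ltW.
Qed.

Lemma le_mean F F' : (forall b, b \in blocks c -> F b <= F' b) ->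
  mean F <= mean F'.
Proof.
move=> F0; rewrite /mean big_seq [leRHS]big_seq; apply: ler_sum => b hb.
by rewrite ler_wpM2l ?F0// exprn_ge0// ltW.
Qed.

Lemma eq_mean F F' : (forall b, b \in blocks c -> F b = F' b) ->
  mean F = mean F'.
Proof. by move=> F0; apply/eqP; rewrite eq_le !le_mean// => b /F0->. Qed.

Lemma meanD F F' : mean (fun b => F b + F' b) = mean F + mean F'.
Proof. by rewrite /mean -big_split; apply: eq_bigr => b _; rewrite mulrDr. Qed.

Lemma meanZ (x : R) F : mean (fun b => x * F b) = x * mean F.
Proof. by rewrite /mean big_distrr; apply: eq_bigr => b _ /=; lra. Qed.

Lemma mean_cst (x : R) : mean (fun=> x) = x.
Proof. by rewrite /mean -big_distrl /= sum_q mul1r. Qed.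

Lemma mean_size_ge1 : 1 <= mean (fun b => (size b)%:R).
Proof.
rewrite -[leLHS]mean_cst; apply: le_mean => b /size_blocks/andP[b0 _].
by rewrite ler1n.
Qed.

Lemma sumn_block_le b : b \in blocks c ->
  (sumn b)%:R <= \sum_(b <- blocks c) (sumn b)%:R :> R.
Proof.
elim: (blocks c) => // b' s IH; rewrite inE big_cons => /predU1P[->|/IH h].
  by rewrite lerDl sumr_ge0.
by apply: le_trans h _; rewrite lerDr.
Qed.

(** As in renewal theory, the rate is the mean digit sum of a block divided by its mean length. *)
Lemma summand_count_concentrated : (1 < sumn c)%N ->
  exists2 ka : R, 0 < ka &
    concentrated c q (fun a => (sumn a).-1%:R) ka.
Proof.
move=> c1; set mu := mean (fun b => (size b)%:R).
have mu1 : 1 <= mu := mean_size_ge1.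
exists (mean (fun b => (sumn b)%:R) / mu).
  rewrite divr_gt0//; last lra.
  (* The witness is [[:: c_1; 0]] when [c] has at least two coefficients, and [[:: 1]] otherwise,
     where [c_1 > 1]. *)
  have [b hb b0] : exists2 b, b \in blocks c & (0 < sumn b)%N.
    have [c2|c2] := leqP 2 (size c).
      exists (rcons (take 1 c) 0%N).
        by apply/blocksP; exists 1%N, 0%N; rewrite c2 cpos.
      by have := cpos (ltnW c2); case: (c) => //= d s; rewrite take0 /=; lia.
    case: (c) c1 c2 => [//|d [|//]] /=; rewrite addn0 => d1 _.
    exists [:: 1%N] => //; apply/blocksP; exists 0%N, 1%N; split => //.
  rewrite /mean big_seq (perm_big _ (perm_to_rem hb)) big_cons hb.
  apply: ltr_wpDr.
    apply: sumr_ge0 => b' _; rewrite mulr_ge0// exprn_ge0//; exact: ltW.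
  by rewrite mulr_gt0 ?ltr0n// exprn_gt0.
apply: (@concentrated_bounded_diff R c q q0 (fun a => (sumn a)%:R) _ _ 1).
  move=> a; case: (sumn a) => [|k]; first by rewrite subrr normr0.
  by rewrite -natr1 opprD addrA subrr sub0r normrN normr1.
apply: (concentrated_drift q0 sum_q (M := \sum_(b <- blocks c) (sumn b)%:R)).
  move=> b w hb; rewrite sumn_cat natrD addrK ger0_norm//.
  exact: sumn_block_le.
move=> w; rewrite divfK; last by rewrite gt_eqF//; lra.
by apply: eq_mean => b _; rewrite sumn_cat natrD addrK.
Qed.

(* The number of gaps equal to [k] created by prepending a block depends on the
   block and on the number [z] of leading zeros.  Adding the bounded corrector
   [H z], the solution of [H z = v z + q' * H z.+1] with [q'] the weight of the
   block [:: 0], makes the mean increment independent of [z]. *)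
Lemma gap_count_concentrated k : exists al : R,
  concentrated c q (fun a => (count_mem k (behead (gaps 0 a)))%:R) al.
Proof.
pose U z := mean (fun b => (count_mem k (gaps z b))%:R).
pose v z := U z - U k.
pose q' := mean (fun b => (b == [:: 0%N])%:R).
(* [v] vanishes from [k] on, so iterating the equation for [H] stops after [k] terms. *)
pose H z := \sum_(i < k) q' ^+ i * v (z + i)%N.
pose E := mean (fun b => (sumn b)%:R).
have count_le z b : (count_mem k (gaps z b) <= sumn b)%N.
  by rewrite -(size_gaps z) count_size.
have vk z : (k <= z)%N -> v z = 0.
  move=> kz; apply/eqP; rewrite subr_eq0; apply/eqP; apply: eq_mean => b _.
  by rewrite (count_gaps_stable b kz (leqnn k)).
have q'0 : 0 <= q' by apply: mean_ge0.
have q'1 : q' <= 1.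
  by rewrite -[leRHS]mean_cst; apply: le_mean => b _; case: eqP.
have HS z : H z = v z + q' * H z.+1.
  have : \sum_(i < k.+1) q' ^+ i * v (z + i)%N = H z.
    by rewrite big_ord_recr /= vk ?leq_addl// mulr0 addr0.
  move=> <-; rewrite big_ord_recl /= expr0 mul1r addn0 big_distrr /=.
  congr (_ + _); apply: eq_bigr => i _.
  by rewrite /bump /= add1n addnS exprS mulrA.
have U0 z : 0 <= U z <= E.
  rewrite mean_ge0//=; apply: le_mean => b _.
  by rewrite ler_nat.
have vE z : `|v z| <= E.
  by have := U0 z; have := U0 k; rewrite /v ler_norml; lra.
have HE z : `|H z| <= k%:R * E.
  apply: le_trans (ler_norm_sum _ _ _) _.
  rewrite -[k in k%:R]card_ord -sum1_card natr_sum big_distrl /=.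
  apply: ler_sum => i _; rewrite normrM; apply: ler_pM => //.
  by rewrite ger0_norm ?exprn_ge0// exprn_ile1.
set mu := mean (fun b => (size b)%:R).
have mu1 : 1 <= mu := mean_size_ge1.
pose X a : R := (count_mem k (gaps 0 a))%:R + H (leading_zeros 0 a).
have dX b w : X (b ++ w) - X w = (count_mem k (gaps (leading_zeros 0 w) b))%:R +
    (H (leading_zeros (leading_zeros 0 w) b) - H (leading_zeros 0 w)).
  by rewrite /X gaps_cat count_cat leading_zeros_cat natrD; lra.
exists ((U k + (1 - q') * H 0%N) / mu).
apply: (@concentrated_bounded_diff R c q q0 X _ _ (1 + k%:R * E)).
  move=> a; rewrite /X.
  apply: (@le_trans _ _ (`|(count_mem k (behead (gaps 0 a)))%:R
            - (count_mem k (gaps 0 a))%:R| + `|H (leading_zeros 0 a)|)).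
    by rewrite opprD addrA ler_normB.
  apply: lerD (HE _); case: (gaps 0 a) => [|g s] /=.
    by rewrite subrr normr0.
  by rewrite natrD opprD addrCA subrr addr0 normrN; case: eqP;
    rewrite ?normr1 ?normr0.
pose S : R := \sum_(b <- blocks c) (sumn b)%:R.
apply: (concentrated_drift q0 sum_q (M := S + (k%:R * E + k%:R * E))).
  move=> b w hb; rewrite dX; apply: le_trans (ler_normD _ _) _; apply: lerD.
    rewrite ger0_norm//; apply: le_trans (sumn_block_le hb).
    by rewrite ler_nat.
  by apply: le_trans (ler_normB _ _) _; apply: lerD.
move=> w; rewrite divfK; last by rewrite gt_eqF//; lra.
set z := leading_zeros 0 w.
(* The run [z] becomes [z.+1] with probability [q'] and 0 otherwise; the equation for [H] then
   cancels every term depending on [z]. *)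
transitivity (U z + ((H z.+1 - H 0%N) * q' + H 0%N - H z)).
  rewrite -[_ + H 0%N - _]addrA -[H 0%N - H z]mean_cst -meanZ -!meanD.
  apply: eq_mean => b hb; rewrite dX (leading_zeros_block _ cpos hb).
  by case: eqP => _ /=; lra.
rewrite (HS z) /v; lra.
Qed.

End Drift.

(** * The characteristic root and the growth of [G] *)

Lemma sum_blocksE (R : realType) (c : seq nat) (x : R) :
  \sum_(b <- blocks c) x ^+ size b =
  \sum_(p < size c) (nth 0%N c p)%:R * x ^+ p.+1.
Proof.
rewrite /blocks big_allpairs_dep /= big_seq.
rewrite -[RHS](big_mkord xpredT (fun p => (nth 0%N c p)%:R * x ^+ p.+1)).
rewrite /index_iota subn0 [RHS]big_seq; apply: eq_bigr => p.
rewrite mem_iota => /= hp.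
under eq_bigr do rewrite size_block//.
by rewrite big_const_seq count_predT size_iota iter_addr addr0 mulr_natl.
Qed.

(** Intermediate value theorem on [[0, 1]]: the polynomial is -1 at 0, and nonnegative at 1 because
    [c_1 >= 1]. *)
Lemma characteristic_root (R : realType) (c : seq nat) : (0 < size c)%N ->
  (forall i, (i < size c)%N -> (0 < nth 0%N c i)%N) ->
  exists q : R, [/\ 0 < q, q <= 1 & \sum_(b <- blocks c) q ^+ size b = 1].
Proof.
move=> c0 cpos.
pose P : {poly R} := \sum_(p < size c) (nth 0%N c p)%:R *: 'X^(p.+1) - 1.
have PE x : P.[x] = \sum_(b <- blocks c) x ^+ size b - 1.
  rewrite sum_blocksE /P hornerD hornerN hornerC horner_sum; congr (_ - _).
  by apply: eq_bigr => p _; rewrite hornerZ hornerXn.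
have P0 : P.[0] = -1.
  rewrite PE sum_blocksE big1 ?sub0r// => p _.
  by rewrite expr0n mulr0.
have P1 : 0 <= P.[1].
  rewrite PE sum_blocksE subr_ge0; case: (size c) c0 cpos => // L _ cpos.
  rewrite big_ord_recl /= expr1n mulr1.
  apply: ler_wpDr; last by rewrite ler1n cpos.
  by apply: sumr_ge0 => i _; rewrite expr1n mulr1.
have [||q /andP[q0 q1] /eqP Pq] := @poly_ivt R P 0 1.
- exact: ler01.
- by rewrite P0 P1 andbT; lra.
exists q; split=> //; last by move: Pq; rewrite PE => /subr0_eq.
rewrite lt_def q0 andbT; apply/eqP => q00; move: Pq.
by rewrite q00 P0 => /eqP; rewrite oppr_eq0 oner_eq0.
Qed.

Lemma recurrence_seq_growth (R : realType) (c : seq nat) (G : nat -> nat) (q : R) :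
  (0 < size c)%N -> (forall i, (i < size c)%N -> (0 < nth 0%N c i)%N) ->
  recurrence_seq c G -> (1 < sumn c)%N -> 0 < q -> q <= 1 ->
  \sum_(b <- blocks c) q ^+ size b = 1 ->
  forall n, (2 <= n)%N ->
    q ^+ (size c + 2) <= (G n.+1 - G n)%:R * q ^+ n.
Proof.
move=> c0 cpos hG c1 q0 q1 sum_q.
have qX n : 0 < q ^+ n by rewrite exprn_gt0.
(* From [size c] on, the recurrence makes [G n.+1 * q ^+ n] an average of earlier such terms with
   weights [c_i * q ^+ i], of sum 1; so a lower bound on the initial terms persists. *)
have low n : q ^+ size c <= (G n.+1)%:R * q ^+ n.
  elim/ltn_ind: n => n IH.
  have [nc|nc] := ltnP n (size c).
    apply: (@le_trans _ _ (q ^+ n)).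
      by apply: ler_wiXn2l => //; [exact: ltW|exact: ltnW].
    by apply: ler_peMl; [exact: ltW|rewrite ler1n (recurrence_seq_gt0 c0)].
  rewrite (recurrence_seqS hG) ltnNge nc addn0 (minn_idPr nc).
  rewrite -[leLHS]mulr1 -[X in _ * X]sum_q sum_blocksE natr_sum.
  rewrite big_distrr big_distrl /=; apply: ler_sum => i _.
  have hi : (i < n)%N by exact: leq_trans nc.
  rewrite natrM mulrCA -mulrA; apply: ler_wpM2l => //.
  have -> : q ^+ n = q ^+ (n - i.+1) * q ^+ i.+1 by rewrite -exprD subnK.
  rewrite mulrA; apply: ler_wpM2r; first exact: ltW.
  by have := IH (n - i.+1)%N; rewrite -subSn// subSS; apply; lia.
move=> [//|[//|n]] _.
(* [G n.+3 >= G n.+2 + G n.+1], from [c_1, c_2 >= 1] or, for a single coefficient, from [c_1 >= 2].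
   The shift by two indices costs the factor [q ^+ 2]. *)
apply: (@le_trans _ _ ((G n.+1)%:R * q ^+ n.+2)); last first.
  apply: ler_wpM2r; first exact: ltW.
  rewrite ler_nat leq_subRL; last first.
    by apply: (recurrence_seq_nondecreasing c0 cpos hG); rewrite /=.
  have [c2|c2] := leqP 2 (size c).
    have := @leq_recurrence_seq c G hG n.+2 2 isT c2.
    rewrite big_ord_recl big_ord1 /= subn0 /bump /= subSS subn0.
    by apply: leq_trans; apply: leq_add; rewrite leq_pmull// cpos.
  have h1 := @leq_recurrence_seq c G hG n.+2 1 isT c0.
  have h2 : (G n.+1 <= G n.+2)%N.
    by apply: (recurrence_seq_nondecreasing c0 cpos hG); rewrite /=.
  move: h1; rewrite big_ord1 subn0; apply: leq_trans.
  have c01 : (1 < nth 0%N c 0)%N by case: (c) c1 c2 => [//|d [|//]] /=; lia.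
  apply: (@leq_trans (2 * G n.+2)); first by rewrite mul2n -addnn leq_add2l.
  by rewrite leq_mul2r c01 orbT.
rewrite addn2 !exprSr !mulrA; do 2! (apply: ler_wpM2r; first exact: ltW).
exact: low.
Qed.

(** * Uniform integers *)

(* The bound on [sumn (s n) / size (s n)] gives tightness: by Markov's
   inequality at most [x / A] of the entries of [s n] are [>= A]. *)
Lemma empirical_mean_cvg (R : realType) (s : nat -> seq nat) (P : nat -> R)
    (x M : R) (f : nat -> R) :
  (forall k, (count_mem k (s n))%:R / (size (s n))%:R @[n --> \oo] --> P k) ->
  (\forall n \near \oo, (sumn (s n))%:R / (size (s n))%:R <= x) ->
  (forall k, 0 <= f k <= M) ->
  exists S : R, \sum_(0 <= k < A) P k * f k @[A --> \oo] --> S /\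
    (\sum_(g <- s n) f g) / (size (s n))%:R @[n --> \oo] --> S.
Proof.
move=> sP sx fM.
have M0 : 0 <= M by have := fM 0%N; lra.
pose I n := (\sum_(g <- s n) f g) / (size (s n))%:R.
pose T A n := \sum_(0 <= k < A) (count_mem k (s n))%:R / (size (s n))%:R * f k.
pose S A := \sum_(0 <= k < A) P k * f k.
have TS A : T A n @[n --> \oo] --> S A.
  apply: cvg_big => [|k _]; first exact: add_continuous.
  by apply: cvgM (sP k) _; exact: cvg_cst.
have count_sum A (t : seq nat) :
    \sum_(g <- t | (g < A)%N) f g = \sum_(0 <= k < A) (count_mem k t)%:R * f k.
  elim: t => [|g t IH].
    by rewrite big_nil big1// => k _; rewrite mul0r.
  rewrite big_cons IH.
  under [RHS]eq_bigr do rewrite /= natrD mulrDl.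
  rewrite big_split /=; case: ifP => gA.
    congr (_ + _); rewrite big_mkord (bigD1 (Ordinal gA)) //= eqxx mul1r.
    rewrite big1 ?addr0// => i /eqP ig.
    by case: eqP => [gi|]; rewrite ?mul0r//; case: ig; apply: val_inj.
  rewrite [X in _ = X + _]big1_seq ?add0r// => k; rewrite mem_index_iota => /andP[_ kA].
  by case: eqP => [gk|]; rewrite ?mul0r//; move: gA kA; rewrite gk /= => ->.
have TE A n : T A n = (\sum_(g <- s n | (g < A)%N) f g) / (size (s n))%:R.
  rewrite count_sum big_distrl; apply: eq_bigr => k _; exact: mulrAC.
have T_le A n : T A n <= I n.
  rewrite TE /I ler_wpM2r// [leRHS](bigID (fun g => g < A)%N) /=.
  by rewrite lerDl sumr_ge0// => g _; case/andP: (fM g).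
have I_le A n : (0 < A)%N ->
    I n <= T A n + M / A%:R * ((sumn (s n))%:R / (size (s n))%:R).
  move=> A0; rewrite TE /I mulrA -mulrDl ler_wpM2r//.
  rewrite [leLHS](bigID (fun g => g < A)%N) /= lerD2l.
  elim: (s n) => [|g t IH]; first by rewrite big_nil mulr0.
  rewrite big_cons /= natrD mulrDr; case: ifPn; rewrite -?leqNgt => gA.
    apply: lerD => //; apply: (@le_trans _ _ M); first by case/andP: (fM g).
    by rewrite mulrAC -mulrA ler_peMr// ler_pdivlMr ?ltr0n// mul1r ler_nat.
  apply: le_trans IH _; rewrite lerDr mulr_ge0// divr_ge0//.
have x0 : 0 <= x.
  have [n [_ hn]] : exists n, [set: nat] n /\ (sumn (s n))%:R / (size (s n))%:R <= x.
    by case: sx => N _ hN; exists N; split=> //; apply: hN => /=.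
  by apply: le_trans hn; rewrite divr_ge0.
(* Letting [n] grow in [T A' n <= I n <= T A n + ...] bounds every partial sum, so the nondecreasing
   [S] converges, to within the tail error of [S A]. *)
have S_le A A' : (0 < A)%N -> S A' <= S A + M / A%:R * x.
  move=> A0.
  have TSx : T A n + M / A%:R * x @[n --> \oo] --> S A + M / A%:R * x.
    by apply: cvgD; [exact: TS|exact: cvg_cst].
  apply: ler_cvg_to (TS A') TSx _; near=> n.
  apply: le_trans (T_le A' n) (le_trans (I_le A n A0) _).
  have hx : (sumn (s n))%:R / (size (s n))%:R <= x by near: n.
  by rewrite lerD2l ler_wpM2l// divr_ge0.
have S_nd : {homo S : A A' / (A <= A')%N >-> A <= A'}.
  move=> A A' AA'; rewrite /S (big_cat_nat (n := A) (leq0n A) AA') /= lerDl.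
  apply: sumr_ge0 => k _; apply: mulr_ge0; last by case/andP: (fM k).
  by apply: ler_cvg_to (cvg_cst 0) (sP k) _; apply: nearW => n; exact: divr_ge0.
have S_cvg : cvgn S.
  by apply: nondecreasing_is_cvgn => //; exists (S 1%N + M / 1%:R * x) => _ [n _ <-];
    exact: S_le.
exists (limn S); split; first exact: S_cvg.
apply/cvgrPdist_le => e e0.
pose A := (Num.truncn (M * x / (e / 2))).+1.
have A0 : 0 < A%:R :> R by rewrite ltr0n.
have hA : M / A%:R * x <= e / 2.
  rewrite mulrAC ler_pdivrMr// [leRHS]mulrC -ler_pdivrMr ?divr_gt0//.
  exact/ltW/truncnS_gt.
have lo : S A <= limn S by exact: nondecreasing_cvgn_le.
have hi : limn S <= S A + M / A%:R * x.
  by apply: limr_le => //; apply: nearW => n; exact: S_le.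
near=> n.
have hT : `|S A - T A n| <= e / 2.
  by near: n; have /cvgrPdist_le := TS A; apply; rewrite divr_gt0.
have hx : (sumn (s n))%:R / (size (s n))%:R <= x by near: n.
have h1 := T_le A n; have := I_le A n isT.
have : M / A%:R * ((sumn (s n))%:R / (size (s n))%:R) <= M / A%:R * x.
  by apply: ler_wpM2l => //; exact: divr_ge0.
move: hT; rewrite -/(I n) !ler_norml; lra.
Unshelve. all: by end_near.
Qed.

Section Integers.
Variables (R : realType) (c : seq nat) (G : nat -> nat) (q : R).
Hypothesis c0 : (0 < size c)%N.
Hypothesis cpos : forall i, (i < size c)%N -> (0 < nth 0%N c i)%N.
Hypothesis hG : recurrence_seq c G.
Hypothesis c1 : (1 < sumn c)%N.
Hypothesis q0 : 0 < q.
Hypothesis q1 : q <= 1.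
Hypothesis sum_q : \sum_(b <- blocks c) q ^+ size b = 1.

Definition exponentially_rare (B : nat -> pred nat) : Prop :=
  exists (C r : R) (N : nat), [/\ 0 <= C, 0 <= r, r < 1 & forall n, (N <= n)%N ->
    (count (B n) (index_iota (G n) (G n.+1)))%:R
      <= C * r ^+ n * (G n.+1 - G n)%:R].

Lemma recurrence_seq_lt n : (2 <= n)%N -> (G n < G n.+1)%N.
Proof.
move=> /(recurrence_seq_growth c0 cpos hG c1 q0 q1 sum_q) h.
rewrite -subn_gt0 -(ltr0n R) -(pmulr_lgt0 _ (exprn_gt0 n q0)).
by apply: lt_le_trans h; rewrite exprn_gt0.
Qed.

(** Decomposition injects [[G n, G n.+1)] into the words of length [n], and the growth bound turns
    the weight [q ^+ n] into a uniform probability at the cost of the factor [Q^-1]. *)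
Lemma concentrated_rare (X : seq nat -> R) al (e : R) :
  concentrated c q X al -> 0 < e ->
  exponentially_rare (fun n m =>
    e * n%:R < `|X (legal_decomposition c G m) - al * n%:R|).
Proof.
move=> hX e0; have [C [r [N [C0 r0 r1 h]]]] := hX e e0.
pose Q := q ^+ (size c + 2).
have Q0 : 0 < Q by rewrite exprn_gt0.
exists (C / Q), r, (maxn N 2); split=> //; first by rewrite divr_ge0// ltW.
move=> n; rewrite geq_max => /andP[nN n2].
have qn : 0 < q ^+ n by rewrite exprn_gt0.
rewrite -(ler_pM2r qn); apply: (@le_trans _ _ (C * r ^+ n)).
  apply: le_trans (h n nN); rewrite ler_wpM2r ?(ltW qn)// ler_nat.
  rewrite -!size_filter -(size_map (legal_decomposition c G)).
  have dec m : m \in index_iota (G n) (G n.+1) -> [/\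
      word c (legal_decomposition c G m), size (legal_decomposition c G m) = n
      & coef_value G (legal_decomposition c G m) = m].
    rewrite mem_index_iota; apply: legal_decompositionP => //; exact: ltnW.
  apply: uniq_leq_size.
    rewrite map_inj_in_uniq ?filter_uniq ?iota_uniq// => m m'.
    rewrite !mem_filter => /andP[_ /dec[_ _ hm]] /andP[_ /dec[_ _ hm']] mm'.
    by rewrite -hm -hm' mm'.
  move=> a /mapP[m]; rewrite mem_filter => /andP[hm /dec[wm sm _]] ->.
  by rewrite mem_filter hm -sm mem_words.
have g := recurrence_seq_growth c0 cpos hG c1 q0 q1 sum_q n2.
rewrite -!mulrA; apply: ler_wpM2l => //.
rewrite mulrCA; apply: ler_peMr; first exact: exprn_ge0.
by rewrite mulrC ler_pdivlMr// mul1r.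
Qed.

(** Outside the rare event the error is at most [(e / 2) * n]; inside it is at most [A1 * n], on a
    set of proportion at most [C * r ^+ n]. *)
Lemma average_cvg (X : nat -> R) (al A : R) : 0 <= A ->
  (forall e, 0 < e ->
    exponentially_rare (fun n m => e * n%:R < `|X m - al * n%:R|)) ->
  (forall n m, (0 < n)%N -> (G n <= m < G n.+1)%N -> `|X m| <= A * n%:R) ->
  (\sum_(G n <= m < G n.+1) X m) / (n%:R * (G n.+1 - G n)%:R)
    @[n --> \oo] --> al.
Proof.
move=> A0 rareX XA.
suff key (e : R) : 0 < e -> \forall n \near \oo,
    `|al - (\sum_(G n <= m < G n.+1) X m) / (n%:R * (G n.+1 - G n)%:R)| <= e.
  by apply/cvgrPdist_le => e /key.
move=> e0.
have e2 : 0 < e / 2 by lra.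
have [C [r [N [C0 r0 r1 h]]]] := rareX _ e2.
pose A1 := A + `|al|.
have A10 : 0 <= A1 by rewrite addr_ge0.
have rn : A1 * C * r ^+ n @[n --> \oo] --> A1 * C * 0.
  apply: cvgM; first exact: cvg_cst.
  by apply: cvg_expr; rewrite ger0_norm.
rewrite mulr0 in rn.
near=> n.
have n2 : (2 <= n)%N by near: n; exists 2%N.
have nN : (N <= n)%N by near: n; exists N.
have hr : A1 * C * r ^+ n <= e / 2.
  near: n; move/cvgrPdist_le: rn => /(_ _ e2); apply: filterS => n.
  by rewrite sub0r normrN; apply: le_trans; exact: ler_norm.
set D : R := (G n.+1 - G n)%:R.
have D0 : 0 < D by rewrite ltr0n subn_gt0 recurrence_seq_lt.
have n0 : 0 < n%:R :> R by rewrite ltr0n; lia.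
have nD : 0 < n%:R * D by rewrite mulr_gt0.
rewrite distrC -(ler_pM2r nD) -[X in _ * X <= _](gtr0_norm nD) -normrM.
rewrite mulrBl divfK ?gt_eqF//.
have -> : al * (n%:R * D) = \sum_(G n <= m < G n.+1) al * n%:R.
  by rewrite sumr_const_nat -[RHS]mulr_natr -mulrA.
rewrite -sumrB; apply: le_trans (ler_norm_sum _ _ _) _.
have h3 : \sum_(G n <= m < G n.+1) `|X m - al * n%:R| <=
   \sum_(G n <= m < G n.+1) ((e / 2) * n%:R +
   A1 * n%:R * (e / 2 * n%:R < `|X m - al * n%:R|)%R%:R).
  rewrite big_nat [leRHS]big_nat; apply: ler_sum => m hm.
  have en : 0 <= e / 2 * n%:R by rewrite mulr_ge0// ltW.
  have [bad|] := boolP (_ < _); last by rewrite -leNgt mulr0 addr0.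
  rewrite mulr1; apply: le_trans (ler_normB _ _) _.
  have := XA n m (ltnW n2) hm; rewrite normrM (gtr0_norm n0) /A1; lra.
apply: le_trans h3 _.
rewrite big_split /= sumr_const_nat -big_distrr /= -[X in X + _]mulr_natr.
have -> : \sum_(G n <= m < G n.+1) (e / 2 * n%:R < `|X m - al * n%:R|)%R%:R =
   (count (fun m => e / 2 * n%:R < `|X m - al * n%:R|)
      (index_iota (G n) (G n.+1)))%:R :> R.
  by rewrite -sum1_count natr_sum [RHS]big_mkcond; apply: eq_bigr => m _; case: ifP.
have := h n nN; rewrite -/D; set K : R := (count _ _)%:R => hK.
have h1 : A1 * n%:R * K <= A1 * n%:R * (C * r ^+ n * D).
  by rewrite ler_wpM2l// mulr_ge0// ltW.
have h2 : A1 * C * r ^+ n * (n%:R * D) <= e / 2 * (n%:R * D).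
  by rewrite ler_wpM2r// ltW.
rewrite -/D; lra.
Unshelve. all: by end_near.
Qed.

Lemma sumn_word a : word c a -> (sumn a <= sumn c * size a)%N.
Proof.
have hsum p : (p < size c)%N -> (sumn (take p c) + nth 0%N c p <= sumn c)%N.
  move=> hp; rewrite -[in leqRHS](cat_take_drop p c) sumn_cat.
  by rewrite (drop_nth 0%N hp) /= addnA leq_addr.
elim=> [t ht|b w /blocksP[p [x [hp hx ->]]] _ IH].
  rewrite size_takel ?(ltnW ht)//; case: t ht => [|t] ht.
    by rewrite take0.
  apply: leq_trans (leq_trans (leq_addr _ _) (hsum _ ht)) _.
  by rewrite leq_pmulr.
rewrite sumn_cat size_cat mulnDr; apply: leq_add IH.
rewrite size_block// sumn_rcons; apply: (@leq_trans (sumn c)); last first.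
  by rewrite leq_pmulr.
by apply: leq_trans (hsum p hp); rewrite leq_add2l ltnW.
Qed.

(** A quotient of two averages whose common normalisation [n * (G n.+1 - G n)] cancels. *)
Lemma gap_proportion_cvg k (al ka : R) : 0 < ka ->
  concentrated c q (fun a => (count_mem k (behead (gaps 0 a)))%:R) al ->
  concentrated c q (fun a => (sumn a).-1%:R) ka ->
  gap_proportion R c G n k @[n --> \oo] --> al / ka.
Proof.
move=> ka0 hal hka.
have bnd n m : (0 < n)%N -> (G n <= m < G n.+1)%N ->
    (sumn (legal_decomposition c G m) <= sumn c * n)%N.
  by move=> n0 /(legal_decompositionP c0 cpos hG n0)[/sumn_word h <- _].
have cal := @average_cvg
  (fun m => (count_mem k (behead (gaps 0 (legal_decomposition c G m))))%:R)
  al (sumn c)%:R (ler0n _ _) (fun e => concentrated_rare hal) _.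
have cka := @average_cvg (fun m => (sumn (legal_decomposition c G m)).-1%:R)
  ka (sumn c)%:R (ler0n _ _) (fun e => concentrated_rare hka) _.
apply: cvg_trans (cvgM (cal _) (cvgV _ (cka _))); first last.
- move=> n m n0 hm; rewrite ger0_norm// -natrM ler_nat.
  by apply: leq_trans (bnd n m n0 hm); exact: leq_pred.
- by rewrite gt_eqF.
- move=> n m n0 hm; rewrite ger0_norm// -natrM ler_nat.
  apply: leq_trans (bnd n m n0 hm); apply: leq_trans (count_size _ _) _.
  by rewrite size_behead size_gaps leq_pred.
apply: near_eq_cvg; near=> n.
have n2 : (2 <= n)%N by near: n; exists 2%N.
have nD : n%:R * (G n.+1 - G n)%:R != 0 :> R.
  by rewrite mulf_neq0 ?pnatr_eq0// ?subn_eq0 -?ltnNge ?recurrence_seq_lt//; lia.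
rewrite /gap_proportion /= !natr_sum.
under [X in _ = X / _]eq_bigr do rewrite sum_gap_eq.
under [X in _ = _ / X]eq_bigr do rewrite num_summandsE.
by rewrite invf_div mulrA divfK.
Unshelve. all: by end_near.
Qed.

End Integers.

(** * Almost sure convergence *)

Lemma uniform_on_seq (R : realType) (d : measure_display)
    (Omega : measurableType d) (Pr : probability Omega R) (X : {RV Pr >-> nat})
    (a b : nat) (s : seq nat) :
  uniform_on X a b -> uniq s -> {subset s <= index_iota a b} ->
  distribution Pr X [set` s] = ((size s)%:R / (b - a)%:R)%:E.
Proof.
move=> hX; elim: s => [|x s IH] /=.
  by move=> _ _; rewrite set_nil measure0 mul0r.
move=> /andP[xs us] ss.
have -> : [set` x :: s] = [set x] `|` [set` s].
  apply/seteqP; split=> y /=; first by rewrite inE => /predU1P[]; [left|right].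
  by move=> [->|ys]; rewrite inE ?eqxx ?ys ?orbT.
rewrite measureU//; last first.
  apply/seteqP; split => // y [/= -> ys]; by rewrite ys in xs.
rewrite [X in (X + _)%E](hX x) [X in (_ + X)%E]IH//; last by move=> y ys; apply: ss; rewrite inE ys orbT.
have := ss x (mem_head _ _); rewrite mem_index_iota => ->.
by rewrite -EFinD -natr1 mulrDl mul1r addrC.
Qed.

Lemma geometric_nneseries_lty (R : realType) (C r : R) :
  0 <= C -> 0 <= r -> r < 1 ->
  (\sum_(0 <= n <oo) (C * r ^+ n)%:E < +oo)%E.
Proof.
move=> C0 r0 r1.
have t0 n : (0 <= (C * r ^+ n)%:E)%E by rewrite lee_fin mulr_ge0// exprn_ge0.
apply: (@le_lt_trans _ _ (C / (1 - r))%:E); last exact: ltry.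
apply: lime_le; first by apply: is_cvg_nneseries => n _ _; exact: t0.
apply: nearW => n; rewrite sumEFin lee_fin.
have r1' : 0 < 1 - r by lra.
rewrite ler_pdivlMr// -big_distrr /= -mulrA ler_piMr//.
suff -> : (\sum_(0 <= i < n) r ^+ i) * (1 - r) = 1 - r ^+ n.
  by rewrite gerBl exprn_ge0.
elim: n => [|n IH]; first by rewrite big_nil mul0r subrr.
by rewrite big_nat_recr//= mulrDl IH exprSr; lra.
Qed.

Lemma exponentially_rare_ae (R : realType) (G : nat -> nat) (B : nat -> pred nat)
    (d : measure_display) (Omega : measurableType d) (Pr : probability Omega R)
    (m : nat -> {RV Pr >-> nat}) :
  (forall n, (2 <= n)%N -> (G n < G n.+1)%N) ->
  (forall n, (1 <= n)%N -> uniform_on (m n) (G n) (G n.+1)) ->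
  exponentially_rare R G B ->
  {ae Pr, forall w, \forall n \near \oo,
     (G n <= m n w < G n.+1)%N /\ ~~ B n (m n w)}.
Proof.
move=> Glt unif [C [r [N [C0 r0 r1 hB]]]].
(* Values outside the interval count as bad too, so Borel-Cantelli for the complements gives both
   conclusions at once. *)
pose good n := [seq x <- index_iota (G n) (G n.+1) | ~~ B n x].
pose F n := if (maxn N 2 <= n)%N then ~` (m n @^-1` [set` good n]) else set0.
have mF n : measurable (F n).
  rewrite /F; case: ifP => // _; apply: measurableC.
  exact: measurable_funPTI.
have PF n : (Pr (F n) <= (C * r ^+ n)%:E)%E.
  rewrite /F; case: ifP => hn; last first.
    by rewrite measure0 lee_fin mulr_ge0// exprn_ge0.
  move: hn; rewrite geq_max => /andP[nN n2].
  rewrite probability_setC; last exact: measurable_funPTI.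
  have -> : Pr (m n @^-1` [set` good n]) = distribution Pr (m n) [set` good n].
    by [].
  rewrite (uniform_on_seq (unif n (ltnW n2))) ?filter_uniq ?iota_uniq//; last first.
    by move=> x; rewrite mem_filter => /andP[].
  have D0 : 0 < (G n.+1 - G n)%:R :> R by rewrite ltr0n subn_gt0 Glt.
  rewrite -EFinB lee_fin -(ler_pM2r D0) mulrBl divfK ?gt_eqF// mul1r.
  apply: le_trans (hB n nN); rewrite lerBlDr -natrD ler_nat size_filter.
  by rewrite count_predC size_iota.
have : (\sum_(0 <= n <oo) Pr (F n) < +oo)%E.
  by apply: le_lt_trans (geometric_nneseries_lty C0 r0 r1); apply: lee_nneseries.
move=> /(lim_sup_set_cvg0 mF) F0.
exists (lim_sup_set F); split => //.
  by apply: bigcap_measurable => // n _; exact: bigcup_measurable.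
move=> w /= hw n _; apply: contrapT => nF; apply: hw.
exists (maxn (maxn N 2) n) => // k; rewrite /= geq_max => /andP[kN kn].
have : ~ F k w by move=> Fk; apply: nF; exists k.
rewrite /F kN => /contrapT /=.
by rewrite mem_filter mem_index_iota => /andP[].
Qed.

(** On an empty interval every singleton would be null, and hence the whole of [nat]. *)
Lemma uniform_on_nonempty (R : realType) (d : measure_display)
    (Omega : measurableType d) (Pr : probability Omega R) (X : {RV Pr >-> nat})
    (a b : nat) : uniform_on X a b -> (a < b)%N.
Proof.
move=> hX; rewrite ltnNge; apply/negP => ba.
have X0 x : distribution Pr X [set x] = 0%E.
  by rewrite hX; case: ifP => // /andP[ax /(leq_ltn_trans ax)]; rewrite ltnNge ba.
have : distribution Pr X setT = 0%E.
  apply: measure_negligible => //.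
  rewrite -[setT]image_id -(bigcup_imset1 setT id).
  apply: negligible_bigcup => k.
  by exists [set k]; split => //; exact: X0.
by rewrite probability_setT => -[] /eqP; rewrite oner_eq0.
Qed.

(** * Integration against the gap measures *)

Section Integrals.
Variables (R : realType) (f : R -> R).
Hypothesis f0 : forall x, 0 <= f x.
Hypothesis mf : measurable_fun setT f.

Lemma integral_gap_measure c G m :
  (\int[gap_measure R c G m]_x (f x)%:E)%E =
  ((\sum_(g <- behead (gaps 0 (legal_decomposition c G m))) f g%:R) /
   (size (behead (gaps 0 (legal_decomposition c G m))))%:R)%:E.
Proof.
have mfE : measurable_fun [set: measurableTypeR R] (EFin \o f).
  exact/measurable_EFinP.
rewrite /gap_measure ge0_integral_mscale//; last first.
  by move=> x _; rewrite lee_fin.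
rewrite ge0_integral_measure_sum//; last by move=> x _; rewrite lee_fin.
under eq_bigr do rewrite integral_dirac// diracT mul1e.
rewrite -(big_gap 0 +%R c G m (fun g => f g%:R)) sumEFin.
rewrite size_behead size_gaps -num_summandsE -EFinM mulrC.
by [].
Qed.

Lemma integral_atomic_measure (P : nat -> {nonneg R}) (S : R) :
  \sum_(0 <= k < A) (P k)%:num * f k%:R @[A --> \oo] --> S ->
  (\int[atomic_measure P]_x (f x)%:E)%E = S%:E.
Proof.
move=> hS.
have mfE : measurable_fun [set: measurableTypeR R] (EFin \o f).
  exact/measurable_EFinP.
rewrite /atomic_measure ge0_integral_measure_series//; last first.
  by move=> x _; rewrite lee_fin.
under eq_eseriesr => k _.
  rewrite ge0_integral_mscale//; last by move=> x _; rewrite lee_fin.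
  rewrite integral_dirac// diracT mul1e -EFinM.
  over.
apply/cvg_lim => //.
under eq_fun do rewrite sumEFin.
by apply: cvg_EFin => //; exact: nearW.
Qed.

End Integrals.

(** The positive and negative parts of [f] take values in [[0, M]], so [empirical_mean_cvg] applies
    to each, and the finite limits can be subtracted. *)
Lemma gap_measure_cvg (R : realType) c G (x : nat -> nat) (P : nat -> {nonneg R})
    (y : R) :
  let s n := behead (gaps 0 (legal_decomposition c G (x n))) in
  (forall k, (count_mem k (s n))%:R / (size (s n))%:R @[n --> \oo] --> (P k)%:num) ->
  (\forall n \near \oo, (sumn (s n))%:R / (size (s n))%:R <= y) ->
  cvg_in_distribution (fun n => gap_measure R c G (x n)) (atomic_measure P).
Proof.
move=> s sP sy f fcont [M fM].
have nonneg_case (h : R -> R) : measurable_fun setT h ->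
    (forall t, 0 <= h t <= M) -> exists S : R,
    (\int[atomic_measure P]_t (h t)%:E)%E = S%:E /\
    (\int[gap_measure R c G (x n)]_t (h t)%:E)%E @[n --> \oo] --> S%:E.
  move=> mh h0M.
  have h0 t : 0 <= h t by case/andP: (h0M t).
  have [S [S1 S2]] := empirical_mean_cvg sP sy (fun k => h0M k%:R).
  exists S; split; first exact: integral_atomic_measure.
  under eq_fun do rewrite integral_gap_measure//.
  by apply: cvg_EFin => //; exact: nearW.
have mf : measurable_fun setT f := continuous_measurable_fun fcont.
have M0 : 0 <= M := le_trans (normr_ge0 _) (fM 0).
pose fp t := Num.max (f t) 0; pose fn t := Num.max (- f t) 0.
have fpE : (fun t => (f t)%:E)^\+%E = (fun t => (fp t)%:E).
  by apply/funext => t; rewrite funeposE /fp EFin_max.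
have fnE : (fun t => (f t)%:E)^\-%E = (fun t => (fn t)%:E).
  by apply/funext => t; rewrite funenegE /fn EFin_max.
have [||Sp [Ip cp]] := nonneg_case fp.
- by apply: measurable_maxr => //; exact: measurable_cst.
- move=> t; rewrite /fp le_max lexx orbT ge_max M0 andbT.
  exact: le_trans (ler_norm _) (fM t).
have [||Sn [In cn]] := nonneg_case fn.
- by apply: measurable_maxr; [exact: measurableT_comp|exact: measurable_cst].
- move=> t; rewrite /fn le_max lexx orbT ge_max M0 andbT.
  by apply: le_trans (ler_norm _) _; rewrite normrN.
rewrite integralE fpE fnE Ip In.
under eq_fun do rewrite integralE fpE fnE.
by apply: cvgeB.
Qed.

Lemma ae_forall_nat (R : realType) (d : measure_display)
    (Omega : measurableType d) (mu : {measure set Omega -> \bar R})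
    (Q : nat -> Omega -> Prop) :
  (forall k, {ae mu, forall w, Q k w}) -> {ae mu, forall w, forall k, Q k w}.
Proof.
move=> hQ; have := negligible_bigcup hQ.
apply: negligibleS => w /= /existsNP[k hk].
by exists k.
Qed.

Section AlmostSure.
Variables (R : realType) (c : seq nat) (G : nat -> nat) (q : R).
Hypothesis c0 : (0 < size c)%N.
Hypothesis cpos : forall i, (i < size c)%N -> (0 < nth 0%N c i)%N.
Hypothesis hG : recurrence_seq c G.
Hypothesis c1 : (1 < sumn c)%N.
Hypothesis q0 : 0 < q.
Hypothesis q1 : q <= 1.
Hypothesis sum_q : \sum_(b <- blocks c) q ^+ size b = 1.
Variables (d : measure_display) (Omega : measurableType d)
  (Pr : probability Omega R) (m : nat -> {RV Pr >-> nat}).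
Hypothesis unif : forall n, (1 <= n)%N -> uniform_on (m n) (G n) (G n.+1).

(** Taking the tolerances [1 / (j + 1)] leaves only countably many null sets to discard. *)
Lemma concentrated_ae (X : seq nat -> R) (al : R) : concentrated c q X al ->
  {ae Pr, forall w,
    (\forall n \near \oo, (G n <= m n w < G n.+1)%N) /\
    X (legal_decomposition c G (m n w)) / n%:R @[n --> \oo] --> al}.
Proof.
move=> hX.
have Glt n : (2 <= n)%N -> (G n < G n.+1)%N.
  exact: (recurrence_seq_lt c0 cpos hG c1 q0 q1 sum_q).
have j0 j : 0 < (j.+1%:R : R)^-1 by rewrite invr_gt0.
have := ae_forall_nat (fun j => exponentially_rare_ae Glt unif
  (concentrated_rare c0 cpos hG c1 q0 q1 sum_q hX (j0 j))).
apply: filterS => w hw; split.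
  by apply: filterS (hw 0%N) => n [].
apply/cvgrPdist_le => e e0.
pose j := Num.truncn e^-1.
have je : (j.+1%:R : R)^-1 <= e.
  rewrite invf_ple ?posrE//; exact/ltW/truncnS_gt.
near=> n.
have n0 : 0 < n%:R :> R by rewrite ltr0n; near: n; exists 1%N.
have : (G n <= m n w < G n.+1)%N /\
  ~~ (j.+1%:R^-1 * n%:R < `|X (legal_decomposition c G (m n w)) - al * n%:R|).
  by near: n; exact: (hw j).
rewrite -leNgt => -[_ h]; apply: le_trans je.
rewrite distrC -(ler_pM2r n0) -[X in _ * X <= _](gtr0_norm n0) -normrM.
by rewrite mulrBl divfK ?gt_eqF.
Unshelve. all: by end_near.
Qed.

Lemma gap_measure_cvg_ae (al : nat -> R) (ka : R) (P : nat -> {nonneg R}) :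
  0 < ka ->
  (forall k, concentrated c q
     (fun a => (count_mem k (behead (gaps 0 a)))%:R) (al k)) ->
  concentrated c q (fun a => (sumn a).-1%:R) ka ->
  (forall k, (P k)%:num = al k / ka) ->
  {ae Pr, forall w,
    cvg_in_distribution (fun n => gap_measure R c G (m n w)) (atomic_measure P)}.
Proof.
move=> ka0 hal hka hP.
apply: filterS2 (ae_forall_nat (fun k => concentrated_ae (hal k)))
  (concentrated_ae hka).
move=> w hw [rng wka].
pose s n := behead (gaps 0 (legal_decomposition c G (m n w))).
have szs n : size (s n) = (sumn (legal_decomposition c G (m n w))).-1.
  by rewrite /s size_behead size_gaps.
(* The gaps add up to at most [n], and eventually there are at least [(ka / 2) * n] of them, so
   their mean is at most [2 / ka]. *)
apply: (@gap_measure_cvg _ _ _ _ _ (2 / ka)) => [k|].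
  have [_ wk] := hw k; rewrite hP.
  apply: cvg_trans (cvgM wk (cvgV _ wka)); last by rewrite gt_eqF.
  apply: near_eq_cvg; near=> n.
  have n0 : n%:R != 0 :> R by rewrite pnatr_eq0 -lt0n; near: n; exists 1%N.
  by rewrite /= -/(s n) -szs invf_div mulrA divfK.
near=> n.
have n0 : 0 < n%:R :> R by rewrite ltr0n; near: n; exists 1%N.
have hr : (G n <= m n w < G n.+1)%N by near: n.
have hk : ka / 2 <= (sumn (legal_decomposition c G (m n w))).-1%:R / n%:R.
  near: n; apply: (cvgr_ge _ wka); lra.
rewrite -/(s n); rewrite -szs in hk.
have hs : (sumn (s n))%:R <= n%:R :> R.
  rewrite ler_nat.
  have [|_ sz _] := legal_decompositionP c0 cpos hG _ hr.
    by rewrite -(ltr0n R).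
  have sumn_behead (l : seq nat) : (sumn (behead l) <= sumn l)%N.
    by case: l => //= g t; exact: leq_addl.
  rewrite -[leqRHS]sz -sumn_gaps; apply: leq_trans (sumn_behead _) (leq_addr _ _).
have K0 : 0 < (size (s n))%:R :> R.
  by rewrite -(pmulr_lgt0 _ (_ : 0 < n%:R^-1)) ?invr_gt0//; apply: lt_le_trans hk; lra.
rewrite ler_pdivrMr//; apply: le_trans hs _.
have hkn : ka / 2 * n%:R <= (size (s n))%:R by rewrite -ler_pdivlMr.
rewrite mulrAC ler_pdivlMr//; lra.
Unshelve. all: by end_near.
Qed.

End AlmostSure.

(** The hypotheses leave only [c = [:: 1]], where all the intervals [[G n, G n.+1)] are empty. *)
Lemma recurrence_seq_trivial (c : seq nat) (G : nat -> nat) n :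
  (0 < size c)%N -> (forall i, (i < size c)%N -> (0 < nth 0%N c i)%N) ->
  recurrence_seq c G -> (sumn c <= 1)%N -> (0 < n)%N -> G n.+1 = G n.
Proof.
move=> c0 cpos hG c1 n0.
have -> : G n.+1 = (\sum_(i < 1) nth 0%N c i * G (n - i))%N.
  have sc : size c = 1%N.
    case: c c0 cpos c1 {hG} => [//|x [//|y c]] _ cpos /=.
    by have := cpos 0%N isT; have := cpos 1%N isT; rewrite /=; lia.
  rewrite (recurrence_seqS hG) sc ltnNge n0 addn0.
  by have -> : minn n 1 = 1%N by apply/minn_idPr.
rewrite big_ord1 subn0.
have := cpos 0%N c0; case: c c0 cpos c1 {hG} => //= x c _ _ xc x0.
have x1 : x = 1%N by lia.
by rewrite x1 mul1n.
Qed.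

Theorem theorem1p7 (R : realType) (L : nat) (c : L.-tuple nat) (G : nat -> nat)
    (hL : (1 <= L)%N) (hc : forall i : 'I_L, (1 <= tnth c i)%N)
    (hG : recurrence_seq c G) :
  exists P : nat -> {nonneg R},
    (forall k : nat, gap_proportion R c G n k @[n --> \oo] --> (P k)%:num) /\
    (forall (d : measure_display) (Omega : measurableType d)
        (Pr : probability Omega R) (m : nat -> {RV Pr >-> nat}),
      (forall n : nat, (1 <= n)%N -> uniform_on (m n) (G n) (G n.+1)) ->
      {ae Pr, forall w : Omega,
        cvg_in_distribution (fun n => gap_measure R c G (m n w))
          (atomic_measure P)}).
Proof.
have c0 : (0 < size c)%N by rewrite size_tuple.
have cpos i : (i < size c)%N -> (0 < nth 0%N c i)%N.
  rewrite size_tuple => iL.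
  by have := hc (Ordinal iL); rewrite (tnth_nth 0%N).
have [c1|c1] := leqP (sumn c) 1.
  have Gn := recurrence_seq_trivial c0 cpos hG c1.
  (* With empty intervals each proportion is [0 / 0 = 0], and no random variable is uniform on them,
     so the almost sure claim is vacuous. *)
  exists (fun=> 0%:nng); split=> [k|d Omega Pr m unif].
    apply: cvg_near_cst; near=> n.
    rewrite /gap_proportion Gn; last by near: n; exists 1%N.
    by rewrite !big_geq// mul0r.
  have := uniform_on_nonempty (unif 1%N isT).
  by rewrite (Gn 1%N isT) ltnn.
have [q [q0 q1 sum_q]] := characteristic_root R c0 cpos.
have [al hal] := choice (gap_count_concentrated q0 sum_q cpos).
have [ka ka0 hka] := summand_count_concentrated q0 sum_q cpos c1.
have cvgP k := gap_proportion_cvg c0 cpos hG c1 q0 q1 sum_q ka0 (hal k) hka.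
have P0 k : 0 <= al k / ka.
  by apply: ler_cvg_to (cvg_cst 0) (cvgP k) _; apply: nearW => n; exact: divr_ge0.
exists (fun k => NngNum (P0 k)); split=> // d Omega Pr m unif.
exact: (gap_measure_cvg_ae c0 cpos hG c1 q0 q1 sum_q unif ka0 hal hka).
Unshelve. all: by end_near.
Qed.
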